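(* Let $\gamma>0$, let $\mu$ be a Borel probability measure on $\mathbb R$ with finite first absolute moment, and let $\nu$ be an increasing (resp. decreasing) location-scale transform of $\mu$. Consider the problem of minimizing $$\iint |y-y'|\,e^{-\gamma|x-x'|}\,\mathrm d\pi(x,y)\,\mathrm d\pi(x',y')$$ over $\pi\in\Pi(\mu,\nu)$. If $\mu$ is symmetric, the set of all minimizers consists of the comonotone coupling $\pi_{\rm com}$ and the antimonotone coupling $\pi_{\rm ant}$. If $\mu$ is asymmetric, the comonotone coupling (resp. the antimonotone coupling) is the unique minimizer.
   Context: $\Pi(\mu,\nu)$ is the set of all probability measures on $\mathbb R^2$ with marginals $\mu,\nu$. $\nu$ is an increasing (resp. decreasing) location-scale transform of $\mu$ if $\nu=\mu\circ\ell^{-1}$ with $\ell(x)=ax+b$ for some $a>0$ (resp. $a<0$) and $b\in\mathbb R$. $\mu$ is symmetric if there exists $m\in\mathbb R$ with $\mu(A)=\mu(m-A)$ for all Borel sets $A$; otherwise $\mu$ is asymmetric. $Q_\mu(t)=\inf\{x\in\mathbb R:\mu((-\infty,x])\ge t\}$ is the left quantile function. With $U$ uniform on $[0,1]$, $\pi_{\rm com}\in\Pi(\mu,\nu)$ is the law of $(Q_\mu(U),Q_\nu(U))$ and $\pi_{\rm ant}\in\Pi(\mu,\nu)$ is the law of $(Q_\mu(U),Q_\nu(1-U))$. *)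

(* Defs.v *)
From HB Require Import structures.
From mathcomp Require Import all_boot all_order all_algebra.
From mathcomp Require Import all_classical all_reals all_analysis.
From mathcomp Require Import measurable_realfun.

Set Implicit Arguments.
Unset Strict Implicit.
Unset Printing Implicit Defensive.

Import Order.TTheory GRing.Theory Num.Theory.
Import numFieldNormedType.Exports.

Local Open Scope classical_set_scope.
Local Open Scope ring_scope.

(* A MathComp-Analysis measure is a function on all sets, constrained only on
   the measurable ones, so Leibniz equality of measures would be too fine. *)
Definition same_measure d (T : measurableType d) (R : realType)
    (p q : set T -> \bar R) : Prop :=
  forall A : set T, measurable A -> p A = q A.

Definition coupling (R : realType) (mu nu : probability R R)
    (p : probability (R * R)%type R) : Prop :=
  same_measure (pushforward p fst) mu /\ same_measure (pushforward p snd) nu.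

Definition increasing_location_scale (R : realType)
    (mu nu : probability R R) : Prop :=
  exists a b : R,
    0 < a /\ same_measure nu (pushforward mu (fun x : R => a * x + b)).

Definition decreasing_location_scale (R : realType)
    (mu nu : probability R R) : Prop :=
  exists a b : R,
    a < 0 /\ same_measure nu (pushforward mu (fun x : R => a * x + b)).

Definition symmetric_law (R : realType) (mu : probability R R) : Prop :=
  exists m : R, forall A : set R,
    measurable A -> mu A = mu [set m - x | x in A].

(* For t outside ]0, 1[ the set below may be unbounded or empty; inf is then 0
   by the library's convention. Only t in ]0, 1[ matters below, since {0, 1} is
   negligible for the uniform law on [0, 1]. *)
Definition quantile (R : realType) (mu : probability R R) (t : R) : R :=
  inf [set x : R | (t%:E <= mu `]-oo, x]%classic)%E].

Section quantile_couplings.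
Context {R : realType}.
Implicit Types mu nu : probability R R.

Lemma measurable_quantile mu : measurable_fun setT (quantile mu).
Proof.
pose S (t : R) := [set x : R | (t%:E <= mu `]-oo, x]%classic)%E].
have SS s t : s <= t -> S t `<=` S s.
  by move=> st x /=; apply: le_trans; rewrite lee_fin.
pose D := [set t | has_inf (S t)].
have ID s u t : D s -> D t -> s <= u -> u <= t -> D u.
  move=> [_ [l ls]] [[x xt] _] su ut; split; first by exists x; exact: SS xt.
  by exists l => y /(SS _ _ su); exact: ls.
have mD : measurable D.
  apply: is_interval_measurable => s t Ds Dt u /andP[su ut].
  exact: ID Ds Dt su ut.
apply: (measurability (@RGenCInfty.G R)) => [|/= _ [_] [r] -> <-].
  exact: RGenCInfty.measurableE.
rewrite setTI.
have -> : quantile mu @^-1` `[r, +oo[ = [set t | r <= quantile mu t].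
  by apply/seteqP; split => t /=; rewrite in_itv/= andbT.
rewrite -[X in measurable X](setUIDK _ D); apply: measurableU.
  apply: is_interval_measurable => s t [/= rs Ds] [_ Dt] u /andP[su ut].
  have Du := ID _ _ _ Ds Dt su ut; split => //=; apply: (le_trans rs).
  apply: lb_le_inf; first exact: Du.1.
  by move=> x /(SS _ _ su); apply: ge_inf; exact: Ds.2.
have Q0 t : ~ D t -> quantile mu t = 0 by exact: inf_out.
have [r0|r0] := leP r 0.
  rewrite (_ : _ `\` _ = ~` D); first exact: measurableC.
  by apply/seteqP; split => [t [] //|t Dt]; split => //=; rewrite Q0.
rewrite (_ : _ `\` _ = set0)//.
apply/seteqP; split => [t [/= + Dt]|//].
by rewrite Q0// leNgt r0.
Qed.

(* The domain is written [measurableTypeR R] because that is the measurable type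
   on which the library defines [uniform_prob]; it is R with its Borel sets. *)
Definition com_map mu nu (u : measurableTypeR R) : R * R :=
  (quantile mu u, quantile nu u).

Definition ant_map mu nu (u : measurableTypeR R) : R * R :=
  (quantile mu u, quantile nu (1 - (u : R))).

Lemma measurable_com_map mu nu : measurable_fun setT (com_map mu nu).
Proof. by apply: measurable_fun_pair; exact: measurable_quantile. Qed.

Lemma measurable_ant_map mu nu : measurable_fun setT (ant_map mu nu).
Proof.
apply: measurable_fun_pair; first exact: measurable_quantile.
apply: measurableT_comp; first exact: measurable_quantile.
exact: measurable_funB.
Qed.

HB.instance Definition _ mu nu :=
  isMeasurableFun.Build _ _ _ _ (com_map mu nu) (measurable_com_map mu nu).

HB.instance Definition _ mu nu :=
  isMeasurableFun.Build _ _ _ _ (ant_map mu nu) (measurable_ant_map mu nu).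

Definition pi_com mu nu : probability (R * R)%type R :=
  distribution (uniform_prob (@ltr01 R)) (com_map mu nu).

Definition pi_ant mu nu : probability (R * R)%type R :=
  distribution (uniform_prob (@ltr01 R)) (ant_map mu nu).

End quantile_couplings.

Definition cost (R : realType) (gamma : R)
    (p : probability (R * R)%type R) : \bar R :=
  (\int[p]_z \int[p]_z'
     (`|z.2 - z'.2| * expR (- gamma * `|z.1 - z'.1|))%:E)%E.

Definition minimizer (R : realType) (gamma : R) (mu nu : probability R R)
    (p : probability (R * R)%type R) : Prop :=
  coupling mu nu p /\
  forall q : probability (R * R)%type R,
    coupling mu nu q -> (cost gamma p <= cost gamma q)%E.

(* Main.v *)
Require Import Defs.
From HB Require Import structures.
From mathcomp Require Import all_boot all_order all_algebra.
From mathcomp Require Import all_classical all_reals all_analysis.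
From mathcomp Require Import measurable_realfun ring lra.

(** Write [phi d = exp (- gamma * d)], and, for two independent draws [(x, y)]
    and [(x', y')] of a coupling, [d = |x - x'|] and [e = |y - y'| / |a|],
    where [nu] is the image of [mu] under [x |-> a * x + b].  The cost is
    [|a|] times the mean of [e * phi d].  The laws of [d] and of [e] do not
    depend on the coupling, and they are equal, because the affine map
    multiplies distances by [|a|].  Since [- phi / gamma] is strictly concave
    with derivative [phi],
      [excess = (e - d) * phi d + (phi e - phi d) / gamma]
    is nonnegative and vanishes only for [e = d].  The means of [phi e] and
    [phi d] cancel, so the cost equals a constant, [|a|] times the mean of
    [d * phi d], plus [|a|] times the mean of [excess]
    ([cost_decomposition]).  This is a rearrangement inequality for the
    distances of pairs, proved through the tangent lines of a concave function.

    The graph of [x |-> a * x + b] carries a coupling with zero excess, so the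
    minimizers are exactly the couplings with [|y - y'| = |a| * |x - x'|] almost
    surely.  Such a coupling is concentrated on a single line of slope [a] or
    [- a] ([isometric_on_line]).  A coupling concentrated on an increasing line
    is comonotone and one on a decreasing line is antimonotone: the mass that it
    gives to a quadrant of points below and to the left of a given point is,
    respectively, the largest and the smallest value that the marginals allow,
    and these values are those of [pi_com] and [pi_ant] ([on_increasing_line],
    [on_decreasing_line]).
    The slope [a] is always available; the slope [- a] is available exactly
    when [nu] is also the image of [mu] under some [x |-> - a * x + c], which
    amounts to the symmetry of [mu] ([symmetric_lawP]). *)

Set Implicit Arguments.
Unset Strict Implicit.
Unset Printing Implicit Defensive.

Import Order.TTheory GRing.Theory Num.Theory.
Import numFieldNormedType.Exports.

Local Open Scope classical_set_scope.
Local Open Scope ring_scope.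

(** * Double integrals against a probability *)

Definition double_integral d (T : measurableType d) (R : realType)
    (p : set T -> \bar R) (f : T * T -> R) : \bar R :=
  (\int[p]_z \int[p]_z' (f (z, z'))%:E)%E.

Section double_integral_theory.
Context d (T : measurableType d) (R : realType) (p : probability T R).
Implicit Types f g : T * T -> R.

Lemma double_integralE f : measurable_fun setT f -> (forall w, 0 <= f w) ->
  double_integral p f = (\int[p \x p]_w (f w)%:E)%E.
Proof.
move=> mf f0; rewrite (fubini_tonelli1 (EFin \o f))//=.
by apply/measurable_EFinP.
Qed.

Lemma double_integral_ge0 f :
  (forall w, 0 <= f w) -> (0 <= double_integral p f)%E.
Proof.
move=> f0; apply: integral_ge0 => z _.
by apply: integral_ge0 => z' _; rewrite lee_fin.
Qed.

Lemma double_integralD f g :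
  measurable_fun setT f -> measurable_fun setT g ->
  (forall w, 0 <= f w) -> (forall w, 0 <= g w) ->
  double_integral p (f \+ g) = (double_integral p f + double_integral p g)%E.
Proof.
move=> mf mg f0 g0; rewrite !double_integralE//; last 2 first.
- exact: measurable_funD.
- by move=> w; rewrite addr_ge0.
rewrite -ge0_integralD//.
- by move=> w _; rewrite lee_fin.
- exact/measurable_EFinP.
- by move=> w _; rewrite lee_fin.
- exact/measurable_EFinP.
Qed.

Lemma double_integral_lty f (M : R) : measurable_fun setT f ->
  (forall w, 0 <= f w) -> (forall w, f w <= M) ->
  (double_integral p f < +oo)%E.
Proof.
move=> mf f0 fM; rewrite double_integralE//.
apply: (@le_lt_trans _ _ (\int[p \x p]_w (cst M%:E) w)%E).
  apply: ge0_le_integral => //.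
  - by move=> w _; rewrite lee_fin.
  - exact/measurable_EFinP.
  - by move=> w _; rewrite lee_fin.
rewrite integral_cst// [X in (_ * X)%E](_ : _ = 1%E) ?mule1 ?ltry//.
transitivity (p setT * p setT)%E; last by rewrite probability_setT mule1.
by rewrite -(product_measure1E p p)// setXTT.
Qed.

(** The two almost sure quantifiers stay nested because only finitely many good
    points are ever chosen, one after the other. *)
Lemma double_integral_eq0 f : measurable_fun setT f -> (forall w, 0 <= f w) ->
  double_integral p f = 0 <->
  {ae p, forall z, {ae p, forall z', f (z, z') = 0}}.
Proof.
move=> mf f0.
have int0 (g : T -> \bar R) : measurable_fun setT g -> (forall z, 0 <= g z)%E ->
    (\int[p]_z g z = 0)%E <-> {ae p, forall z, g z = 0%E}.
  move=> mg g0; under eq_integral do rewrite -(gee0_abs (g0 _)).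
  rewrite ae_eq_integral_abs//.
  by split; apply: filterS => z; [exact|move=> + _].
rewrite /double_integral int0; last 2 first.
- apply: (measurable_fun_fubini_tonelli_F (EFin \o f)) => //=.
  exact/measurable_EFinP.
- by move=> z; apply: integral_ge0 => z' _; rewrite lee_fin.
have inner z : (\int[p]_z' (f (z, z'))%:E = 0)%E <->
    {ae p, forall z', f (z, z') = 0}.
  rewrite int0; last 2 first.
  - by apply/measurable_EFinP; apply: (measurableT_comp mf).
  - by move=> z'; rewrite lee_fin.
  by split; apply: filterS => z'; [case|move=> ->].
by split; apply: filterS => z /inner.
Qed.

End double_integral_theory.

Lemma eq_double_integral d (T : measurableType d) (R : realType)
    (p q : {measure set T -> \bar R}) (f : T * T -> R) :
  same_measure p q -> double_integral p f = double_integral q f.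
Proof.
move=> pq; rewrite /double_integral (eq_measure_integral q); last first.
  by move=> A mA _; exact: pq.
apply: eq_integral => z _; apply: eq_measure_integral => A mA _; exact: pq.
Qed.

(** The double integral of a function of [X] at two independent draws depends
    only on the law [q] of [X]: this is how distances between first, or between
    second, coordinates lose all memory of the coupling. *)
Lemma double_integral_pushforward d d' (T : measurableType d)
    (T' : measurableType d') (R : realType) (p : probability T R)
    (q : probability T' R)
    (X : T -> T') (g : T' * T' -> R) :
  measurable_fun setT X -> measurable_fun setT g -> (forall w, 0 <= g w) ->
  same_measure (pushforward p X) q ->
  double_integral q g = double_integral p (fun w => g (X w.1, X w.2)).
Proof.
move=> mX mg g0 pq.
pose HX := isMeasurableFun.Build _ _ _ _ X mX.
pose X' : {mfun _ >-> _} := HB.pack X HX.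
have -> : double_integral q g = double_integral (distribution p X') g.
  by apply: eq_double_integral => A mA; exact: esym (pq A mA).
rewrite /double_integral ge0_integral_distribution//; last 2 first.
- apply: (measurable_fun_fubini_tonelli_F (EFin \o g)) => //=.
  exact/measurable_EFinP.
- by move=> z; apply: integral_ge0 => z' _; rewrite lee_fin.
apply: eq_integral => z _ /=.
rewrite ge0_integral_distribution//.
  by apply/measurable_EFinP; apply: (measurableT_comp mg).
by move=> z'; rewrite lee_fin.
Qed.

(** * Affine maps and almost sure comparison of events *)

Lemma measurable_affine (R : realType) (a b : R) :
  measurable_fun setT (fun x : R => a * x + b).
Proof. by apply: measurable_funD => //; exact: measurable_funM. Qed.

Lemma measurable_affine_preimage (R : realType) (a b : R) (A : set R) :
  measurable A -> measurable ((fun x => a * x + b) @^-1` A).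
Proof.
by move=> mA; rewrite -[X in measurable X]setTI; exact: measurable_affine.
Qed.

Section almost_sure_inclusion.
Context d (T : measurableType d) (R : realType) (p : probability T R).
Implicit Types A B : set T.

Lemma ae_le_measure A B : measurable A -> measurable B ->
  {ae p, forall x, A x -> B x} -> (p A <= p B)%E.
Proof.
move=> mA mB [N [mN N0 ABN]].
have BN : p (B `|` N) = p B by rewrite measureU0.
rewrite -[leRHS]BN; apply: le_measure; rewrite ?inE//.
  exact: measurableU.
move=> x Ax; have [Bx|Bx] := pselect (B x); first by left.
by right; apply: ABN => /= /(_ Ax).
Qed.

Lemma ae_eq_measure A B : measurable A -> measurable B ->
  {ae p, forall x, A x <-> B x} -> p A = p B.
Proof.
move=> mA mB AB; apply/eqP; rewrite eq_le.
by rewrite !ae_le_measure//; apply: filterS AB => x [].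
Qed.

End almost_sure_inclusion.

(** * Couplings concentrated on a line *)

Section isometric_couplings.
Context (R : realType) (p : probability (R * R)%type R).

Definition on_line (a c : R) := {ae p, forall z : R * R, z.2 = a * z.1 + c}.

(** If a coupling multiplies distances by [|a|], almost every point lies on the
    cross formed by the two lines of slopes [a] and [- a] through a good point
    [z0].  If the first line is not enough, there is a good point [z1] other
    than [z0] on the second one; the points of the cross of [z0] at the right
    distance from [z1] then all lie on the second line. *)
Lemma isometric_on_line (a : R) : a != 0 ->
  {ae p, forall z : R * R, {ae p, forall z' : R * R,
    `|z.2 - z'.2| = `|a| * `|z.1 - z'.1|}} <->
  exists c, on_line a c \/ on_line (- a) c.
Proof.
move=> a0; split; last first.
  move=> [c onL].
  have {onL}[b ba onL] : exists2 b : R, `|b| = `|a| & on_line b c.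
    by case: onL; [exists a|exists (- a); rewrite ?normrN].
  apply: filterS (onL) => z zL; apply: filterS onL => z' z'L.
  by rewrite zL z'L -ba -normrM; congr (`| _ |); ring.
move=> iso.
have pT : (0 < p setT)%E by rewrite probability_setT lte01.
have [z0 z0E] := @filter_ex _ _ (ae_properfilter_algebraOfSetsType pT) _ iso.
(* [c s] is the intercept of the line of slope [s] through [z0]. *)
pose c s := z0.2 - s * z0.1.
have lines (z : R * R) : `|z0.2 - z.2| = `|a| * `|z0.1 - z.1| ->
    z.2 = a * z.1 + c a \/ z.2 = - a * z.1 + c (- a).
  rewrite -normrM => /eqP; rewrite eqr_norm2 => /orP[]/eqP h; [left|right];
    by rewrite /c; lra.
have [onL|noL] := pselect (on_line a (c a)); first by exists (c a); left.
exists (c (- a)); right.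
have [z1 [[z1E z1L] z1N]] : exists z1 : R * R,
    ({ae p, forall z', `|z1.2 - z'.2| = `|a| * `|z1.1 - z'.1|} /\
     z1.2 = - a * z1.1 + c (- a)) /\ z1.1 != z0.1.
  apply: contrapT => nz1; apply: noL.
  apply: filterS2 iso z0E => z zE /lines[//|zL].
  apply: contrapT => zN; apply: nz1; exists z; split; first by split.
  by apply/eqP => zz0; apply: zN; rewrite zL zz0 /c; ring.
apply: filterS2 z0E z1E => z /lines[zL|//] /eqP.
rewrite -normrM eqr_norm2 => zz1.
suff /eqP zz0 : z.1 == z0.1 by rewrite zL zz0 /c; ring.
move: zz1; rewrite z1L zL /c => /orP[]/eqP h.
- move: z1N; rewrite -subr_eq0 => /negP[]; rewrite -(mulrI_eq0 _ (mulfI a0)).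
  by apply/eqP; lra.
- by rewrite -subr_eq0 -(mulrI_eq0 _ (mulfI a0)); apply/eqP; lra.
Qed.

End isometric_couplings.

(** The law of [(x, a * x + b)] under [mu]; it shows that the lower bound on the
    cost is attained. *)
Lemma graph_coupling_exists (R : realType) (a b : R) (mu nu : probability R R) :
  same_measure nu (pushforward mu (fun x : R => a * x + b)) ->
  exists2 p : probability (R * R)%type R, coupling mu nu p & on_line p a b.
Proof.
move=> nuE; pose G (x : R) : R * R := (x, a * x + b).
have mG : measurable_fun setT G.
  by apply: measurable_fun_pair => //; exact: measurable_affine.
pose HG := isMeasurableFun.Build _ _ _ _ G mG.
pose G' : {mfun _ >-> _} := HB.pack G HG.
exists (distribution mu G').
  by split=> A mA; [|rewrite nuE].
pose D := [set z : R * R | z.2 - (a * z.1 + b) != 0].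
have mD : measurable D.
  rewrite (_ : D = ~` ((fun z : R * R => z.2 - (a * z.1 + b)) @^-1` [set 0])).
    apply: measurableC; rewrite -[X in measurable X]setTI.
    have : measurable_fun setT (fun z : R * R => z.2 - (a * z.1 + b)).
      apply: measurable_funB => //.
      apply: (measurableT_comp (measurable_affine a b)).
      exact: measurable_fst.
    by apply.
  by apply/seteqP; split => z /= /eqP.
exists D; split => //.
  transitivity (mu (G @^-1` D)) => //.
  rewrite (_ : G @^-1` D = set0) ?measure0//.
  by apply/seteqP; split => // x; rewrite /D /= subrr eqxx.
by move=> z /= zN; rewrite /D /= subr_eq0; exact/eqP.
Qed.

(** * The concavity excess *)

(** The gap at [e] between the concave function [- exp (- g * t) / g] and its
    tangent line at [d]. *)
Definition excess (R : realType) (g d e : R) : R :=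
  (e - d) * expR (- g * d) + (expR (- g * e) - expR (- g * d)) / g.

Section excess_theory.
Context (R : realType) (g : R).
Hypothesis g0 : 0 < g.

(** Factoring out the exponential at [d] reduces both facts about the excess to
    [1 + t <= exp t], an equality only at [t = 0]. *)
Lemma excessE d e :
  excess g d e =
  expR (- g * d) / g * (expR (- g * (e - d)) - (1 + - g * (e - d))).
Proof.
rewrite /excess.
have -> : - g * e = - g * d + - g * (e - d) by ring.
by rewrite expRD; field; rewrite gt_eqF.
Qed.

Lemma excess_ge0 d e : 0 <= excess g d e.
Proof.
rewrite excessE; apply: mulr_ge0; first by rewrite divr_ge0 ?expR_ge0// ltW.
by rewrite subr_ge0 expR_ge1Dx.
Qed.

Lemma excess_eq0 d e : excess g d e = 0 <-> e = d.
Proof.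
split=> [|->]; last by rewrite /excess !subrr !mul0r addr0.
apply: contraPP => /eqP ed; apply/eqP; rewrite gt_eqF// excessE mulr_gt0//.
  by rewrite divr_gt0// expR_gt0.
rewrite subr_gt0 expR_gt1Dx// mulf_eq0 negb_or oppr_eq0 subr_eq0 ed andbT.
by rewrite gt_eqF.
Qed.

End excess_theory.

Lemma measurable_excess d (T : measurableType d) (R : realType) (g : R)
    (f h : T -> R) : measurable_fun setT f -> measurable_fun setT h ->
  measurable_fun setT (fun x => excess g (f x) (h x)).
Proof.
move=> mf mh.
have mexp (k : T -> R) : measurable_fun setT k ->
    measurable_fun setT (fun x => expR (- g * k x)).
  by move=> mk; apply: measurableT_comp => //; exact: measurable_funM.
apply: measurable_funD; apply: measurable_funM => //.
- exact: measurable_funB.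
- exact: mexp.
- by apply: measurable_funB; exact: mexp.
Qed.

(** * Decomposition of the cost *)

(** The cost of a coupling under which [|y - y'| = |a| * |x - x'|]. *)
Definition isometric_cost (R : realType) (g a : R)
    (mu : probability R R) : \bar R :=
  double_integral mu (fun w : R * R =>
    `|a| * (`|w.1 - w.2| * expR (- g * `|w.1 - w.2|))).

Definition isometry_defect (R : realType) (g a : R)
    (w : (R * R) * (R * R)) : R :=
  `|a| * excess g `|w.1.1 - w.2.1| (`|w.1.2 - w.2.2| / `|a|).

Lemma measurable_isometry_defect (R : realType) (g a : R) :
  measurable_fun setT (isometry_defect g a).
Proof.
have mdist (f h : (R * R) * (R * R) -> R) :
    measurable_fun setT f -> measurable_fun setT h ->
    measurable_fun setT (fun w => `|f w - h w|).
  by move=> mf mh; apply: measurableT_comp => //; exact: measurable_funB.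
apply: measurable_funM => //; apply: measurable_excess.
  by apply: mdist; apply: measurableT_comp.
by apply: measurable_funM => //; apply: mdist; apply: measurableT_comp.
Qed.

Lemma isometry_defect_ge0 (R : realType) (g a : R) : 0 < g ->
  forall w, 0 <= isometry_defect g a w.
Proof.
by move=> g0 w; apply: mulr_ge0; [exact: normr_ge0|exact: excess_ge0].
Qed.

Lemma isometry_defect_eq0 (R : realType) (g a : R) : 0 < g -> a != 0 ->
  forall w, isometry_defect g a w = 0 <->
            `|w.1.2 - w.2.2| = `|a| * `|w.1.1 - w.2.1|.
Proof.
move=> g0 a0 w; have a0' : `|a| != 0 by rewrite normr_eq0.
transitivity (excess g `|w.1.1 - w.2.1| (`|w.1.2 - w.2.2| / `|a|) = 0).
  split=> [/eqP|h]; last by rewrite /isometry_defect h mulr0.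
  by rewrite mulf_eq0 (negbTE a0') => /eqP.
rewrite excess_eq0//; split=> [<-|->]; first by rewrite mulrC divfK.
by rewrite mulrAC divff// mul1r.
Qed.

(** The integrand is bounded: [t * exp (- g * t) <= 1 / g] follows from
    [1 + s <= exp s] at [s = g * t]. *)
Lemma isometric_cost_fin_num (R : realType) (g a : R) (mu : probability R R) :
  0 < g -> isometric_cost g a mu \is a fin_num.
Proof.
move=> g0; have f_ge0 (w : R * R) :
    0 <= `|a| * (`|w.1 - w.2| * expR (- g * `|w.1 - w.2|)).
  by apply: mulr_ge0 => //; apply: mulr_ge0 => //; exact: expR_ge0.
rewrite ge0_fin_numE; last exact: double_integral_ge0.
have mdist : measurable_fun setT (fun w : R * R => `|w.1 - w.2|).
  by apply: measurableT_comp => //; exact: measurable_funB.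
apply: (@double_integral_lty _ _ _ _ _ (`|a| * g^-1)) => //.
  apply: measurable_funM => //; apply: measurable_funM => //.
  by apply: measurableT_comp => //; exact: measurable_funM.
move=> w; apply: ler_wpM2l => //; set t := `|_|.
have := expR_ge1Dx (g * t); rewrite mulNr expRN => h.
rewrite ler_pdivrMr ?expR_gt0// ler_pdivlMl//; lra.
Qed.

Section affine_images.
Context (R : realType) (g a b : R) (mu nu : probability R R).
Hypotheses (g0 : 0 < g) (a0 : a != 0).
Hypothesis nuE : same_measure nu (pushforward mu (fun x : R => a * x + b)).

Let l : R := `|a|.
Let l0 : 0 < l. Proof. by rewrite normr_gt0. Qed.

Let measurable_kernel d (T : measurableType d) (f : T -> R) :
  measurable_fun setT f -> measurable_fun setT (fun x => expR (- g * f x)).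
Proof. by move=> mf; apply: measurableT_comp => //; exact: measurable_funM. Qed.

Let measurable_dist d (T : measurableType d) (f h : T -> R) :
  measurable_fun setT f -> measurable_fun setT h ->
  measurable_fun setT (fun x => `|f x - h x|).
Proof.
by move=> mf mh; apply: measurableT_comp => //; exact: measurable_funB.
Qed.

Let dist (w : R * R) : R := `|w.1 - w.2|.

Let measurable_distR : measurable_fun setT dist.
Proof. exact: measurable_dist. Qed.

(** The defect contains exponentials of both distances with opposite signs.
    Their double integrals are the same finite number [K], because the law of
    [|y - y'| / |a|] is that of [|x - x'|].  [K] is added on both sides, which
    leaves only nonnegative integrands and allows an infinite cost. *)
Lemma cost_decomposition (p : probability (R * R)%type R) : coupling mu nu p ->
  cost g p =
  (isometric_cost g a mu + double_integral p (isometry_defect g a))%E.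
Proof.
move=> [p1 p2].
pose dx (w : (R * R) * (R * R)) : R := `|w.1.1 - w.2.1|.
pose dy (w : (R * R) * (R * R)) : R := `|w.1.2 - w.2.2|.
have mdx : measurable_fun setT dx.
  by apply: measurable_dist; apply: measurableT_comp.
have mdy : measurable_fun setT dy.
  by apply: measurable_dist; apply: measurableT_comp.
pose k (t : R) : R := l * (expR (- g * t) / g).
have k_ge0 t : 0 <= k t.
  by rewrite mulr_ge0 ?divr_ge0 ?expR_ge0// ltW.
have mk d (T : measurableType d) (f : T -> R) :
    measurable_fun setT f -> measurable_fun setT (fun x => k (f x)).
  move=> mf; apply: measurable_funM => //; apply: measurable_funM => //.
  exact: measurable_kernel.
have mdiv d (T : measurableType d) (f : T -> R) :
    measurable_fun setT f -> measurable_fun setT (fun x => f x / l).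
  by move=> mf; exact: measurable_funM.
pose K := double_integral mu (fun w => k (dist w)).
have K_fin : K \is a fin_num.
  rewrite ge0_fin_numE; last exact: double_integral_ge0.
  apply: (@double_integral_lty _ _ _ _ _ (l / g)) => //; first exact: mk.
  move=> w; rewrite /k ler_pM2l// ler_pdivrMr// mulVf ?gt_eqF//.
  rewrite -expR0 ler_expR mulNr oppr_le0.
  by apply: mulr_ge0; [exact: ltW|exact: normr_ge0].
have Kx : double_integral p (fun w => k (dx w)) = K.
  rewrite /K (double_integral_pushforward measurable_fst _ _ p1)//.
  exact: mk.
have Ky : double_integral p (fun w => k (dy w / l)) = K.
  transitivity (double_integral nu (fun w => k (dist w / l))).
    rewrite (double_integral_pushforward measurable_snd _ _ p2)//.
    exact/mk/mdiv.
  have maff : measurable_fun setT (fun x : R => a * x + b).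
    exact: measurable_affine.
  have afnu : same_measure (pushforward mu (fun x : R => a * x + b)) nu.
    by move=> A mA; rewrite nuE.
  rewrite (double_integral_pushforward maff _ _ afnu); last 2 first.
  - exact/mk/mdiv.
  - by move=> w; exact: k_ge0.
  congr double_integral; apply/funext => w; congr k; rewrite /dist /=.
  rewrite (_ : _ - _ = a * (w.1 - w.2)); last by ring.
  by rewrite normrM mulrAC divff ?mul1r// gt_eqF.
pose s (w : (R * R) * (R * R)) : R := l * (dx w * expR (- g * dx w)).
pose r : (R * R) * (R * R) -> R := isometry_defect g a.
have ms : measurable_fun setT s.
  apply: measurable_funM => //; apply: measurable_funM => //.
  exact: measurable_kernel.
have mr : measurable_fun setT r.
  by apply: measurable_funM => //; apply: measurable_excess => //; exact: mdiv.
have s_ge0 w : 0 <= s w.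
  by apply: mulr_ge0; [exact: ltW|rewrite mulr_ge0 ?expR_ge0 ?normr_ge0].
have r_ge0 w : 0 <= r w by apply: mulr_ge0; [exact: ltW|exact: excess_ge0].
have Ks : double_integral p s = (isometric_cost g a mu)%E.
  rewrite /isometric_cost (double_integral_pushforward measurable_fst _ _ p1)//.
  apply: measurable_funM => //; apply: measurable_funM => //.
  exact: measurable_kernel.
pose f w : R := dy w * expR (- g * dx w).
have mf : measurable_fun setT f.
  by apply: measurable_funM => //; exact: measurable_kernel.
have f_ge0 w : 0 <= f w.
  by apply: mulr_ge0; [exact: normr_ge0|exact: expR_ge0].
have balance :
    f \+ (fun w => k (dy w / l)) = (s \+ r) \+ (fun w => k (dx w)).
  apply/funext => w; rewrite /f /k /s /r /isometry_defect /excess /=.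
  rewrite -/l -/(dx w) -/(dy w).
  set u := expR (- g * (dy w / l)); set v := expR (- g * dx w).
  by field; rewrite !gt_eqF.
have mky := mk _ _ _ (mdiv _ _ _ mdy).
have mkx := mk _ _ _ mdx.
pose ky w := k (dy w / l); pose kx w := k (dx w).
have : (double_integral p f + double_integral p ky =
    double_integral p s + double_integral p r +
    double_integral p kx)%E.
  rewrite -(double_integralD p mf mky f_ge0 (fun=> k_ge0 _)) balance.
  rewrite -(double_integralD p ms mr s_ge0 r_ge0).
  have msr : measurable_fun setT (s \+ r) by exact: measurable_funD.
  have sr_ge0 w : 0 <= (s \+ r) w by exact: addr_ge0.
  have kx_ge0 w : 0 <= kx w by exact: k_ge0.
  by rewrite -(double_integralD p msr mkx sr_ge0 kx_ge0).
rewrite Kx Ky Ks => /(congr1 (fun x => x - K)%E); rewrite !addeK//.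
Qed.

End affine_images.

(** * Minimizers are the couplings on a line of slope a or - a *)

Lemma double_integral_defect_eq0 (R : realType) (g a : R)
    (p : probability (R * R)%type R) : 0 < g -> a != 0 ->
  double_integral p (isometry_defect g a) = 0%E <->
  exists c, on_line p a c \/ on_line p (- a) c.
Proof.
move=> g0 a0; rewrite -isometric_on_line// double_integral_eq0//.
- have pointwise z z' := isometry_defect_eq0 g0 a0 (z, z').
  by split; apply: filterS => z; apply: filterS => z' /pointwise.
- exact: measurable_isometry_defect.
- exact: isometry_defect_ge0.
Qed.

(** The first term of [cost_decomposition] is common to all couplings and, being
    finite, cancels; the second is nonnegative and the graph coupling makes it
    vanish. *)
Lemma minimizer_on_line (R : realType) (g a b : R) (mu nu : probability R R)
    (p : probability (R * R)%type R) : 0 < g -> a != 0 ->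
  same_measure nu (pushforward mu (fun x : R => a * x + b)) ->
  minimizer g mu nu p <->
  coupling mu nu p /\ exists c, on_line p a c \/ on_line p (- a) c.
Proof.
move=> g0 a0 nuE; rewrite -(double_integral_defect_eq0 p g0 a0).
have costE := cost_decomposition g0 a0 nuE.
have defect0 (q : probability (R * R)%type R) :
    (0 <= double_integral q (isometry_defect g a))%E.
  by have := double_integral_ge0 q (isometry_defect_ge0 a g0).
split=> [[cp pmin]|[cp p0]]; split=> //; last first.
  by move=> q cq; rewrite !costE// p0 leeD2l.
have [q cq qL] := graph_coupling_exists nuE.
have q0 : double_integral q (isometry_defect g a) = 0%E.
  by apply/double_integral_defect_eq0 => //; exists b; left.
have := pmin _ cq; rewrite !costE// q0 adde0 => h.
apply/eqP; rewrite eq_le defect0 andbT.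
have K_fin := isometric_cost_fin_num a mu g0.
by move: h; rewrite -[X in (_ <= X)%E]adde0 leeD2lE.
Qed.

Lemma minimizer_same_measure (R : realType) (g : R) (mu nu : probability R R)
    (p q : probability (R * R)%type R) :
  same_measure p q -> minimizer g mu nu q -> minimizer g mu nu p.
Proof.
move=> pq [[q1 q2] qmin].
have costE : cost g p = cost g q.
  exact: (@eq_double_integral _ (R * R)%type R p q (fun w =>
    `|w.1.2 - w.2.2| * expR (- g * `|w.1.1 - w.2.1|)) pq).
split; last by move=> r cr; rewrite costE; exact: qmin.
split=> A mA; [rewrite -q1//|rewrite -q2//]; apply: pq.
  by rewrite -[X in measurable X]setTI; exact: measurable_fst.
by rewrite -[X in measurable X]setTI; exact: measurable_snd.
Qed.

(** * Quadrants and quantiles *)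

Definition quadrant (R : realType) (x y : R) : set (R * R) :=
  `]-oo, x]%classic `*` `]-oo, y]%classic.

Lemma measurable_quadrant (R : realType) (x y : R) :
  measurable (quadrant x y).
Proof. exact: measurableX. Qed.

(** The closed quadrants are stable under intersection and exhaust the plane,
    and a countable union of them is the half-plane below a given level of
    either coordinate, so they generate the Borel sets of the plane. *)
Lemma eq_on_quadrants (R : realType) (p q : probability (R * R)%type R) :
  (forall x y, p (quadrant x y) = q (quadrant x y)) -> same_measure p q.
Proof.
move=> pq; pose G : set (set (R * R)) := [set quadrant w.1 w.2 | w in setT].
have nat_above (x : R) : exists n : nat, x <= n%:R.
  exists (Num.bound `|x|); apply: le_trans (ler_norm x) _.
  exact/ltW/archi_boundP.
have mG : @measurable _ (R * R)%type `<=` <<s G >>.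
  suff mid : measurable_fun setT
      (fun z : g_sigma_algebraType G => (z.1, z.2) : (R * R)%type).
    move=> A mA; have := mid measurableT A mA; rewrite setTI.
    by congr (<<s G >> _); apply/seteqP; split => -[].
  apply: measurable_fun_pair.
  - apply: (measurability (@RGenOInfty.G R)) => [|/= _ [_ [r ->] <-]].
      exact: RGenOInfty.measurableE.
    rewrite setTI (_ : _ @^-1` _ = ~` (\bigcup_n quadrant r n%:R)).
      apply: measurableC; apply: bigcupT_measurable => n.
      by apply: sub_sigma_algebra; exists (r, n%:R).
    apply/seteqP; split => -[x y] /=; rewrite in_itv/= andbT.
      by move=> rx [n _ [/=]]; rewrite in_itv/= leNgt rx.
    move=> xyN; rewrite ltNge; apply/negP => xr; apply: xyN.
    by have [n yn] := nat_above y; exists n => //; split; rewrite /= in_itv.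
  - apply: (measurability (@RGenOInfty.G R)) => [|/= _ [_ [r ->] <-]].
      exact: RGenOInfty.measurableE.
    rewrite setTI (_ : _ @^-1` _ = ~` (\bigcup_n quadrant n%:R r)).
      apply: measurableC; apply: bigcupT_measurable => n.
      by apply: sub_sigma_algebra; exists (n%:R, r).
    apply/seteqP; split => -[x y] /=; rewrite in_itv/= andbT.
      by move=> ry [n _ [/= _]]; rewrite in_itv/= leNgt ry.
    move=> xyN; rewrite ltNge; apply/negP => yr; apply: xyN.
    by have [n xn] := nat_above x; exists n => //; split; rewrite /= in_itv.
move=> A mA; apply: (@g_sigma_algebra_measure_unique _ _ _ G _
    (fun n => quadrant n%:R n%:R)).
- by move=> _ [w _ <-]; exact: measurable_quadrant.
- by move=> n; exists (n%:R, n%:R).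
- apply/seteqP; split => // -[x y] _.
  have [n xn] := nat_above x; have [m ym] := nat_above y.
  exists (maxn n m) => //; split; rewrite /= in_itv/=.
    by rewrite (le_trans xn)// ler_nat leq_maxl.
  by rewrite (le_trans ym)// ler_nat leq_maxr.
- move=> _ _ [w _ <-] [w' _ <-].
  exists (Num.min w.1 w'.1, Num.min w.2 w'.2) => //.
  apply/seteqP; split => -[x y]; rewrite /quadrant /= !in_itv /= !le_min.
    by move=> [/andP[? ?] /andP[? ?]].
  by move=> [[-> ->] [-> ->]].
- by move=> _ [w _ <-]; exact: pq.
- by move=> n; rewrite (le_lt_trans (probability_le1 _ _)) ?ltry//;
    exact: measurable_quadrant.
- exact: mG.
Qed.

Section ray_mass.
Context (R : realType) (mu : probability R R).

Definition ray_mass (x : R) : R := fine (mu `]-oo, x]%classic).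

Lemma ray_massE x : mu `]-oo, x]%classic = (ray_mass x)%:E.
Proof. by rewrite /ray_mass fineK// fin_num_measure. Qed.

Lemma ray_mass_ge0 x : 0 <= ray_mass x.
Proof. by rewrite -lee_fin -ray_massE measure_ge0. Qed.

Lemma ray_mass_le1 x : ray_mass x <= 1.
Proof. by rewrite -lee_fin -ray_massE probability_le1. Qed.

Let idR : {RV mu >-> R} :=
  HB.pack (@idfun R)
    (isMeasurableFun.Build _ _ _ _ _ (@measurable_id _ R setT)).

Let cdf_idE x : cdf idR x = (ray_mass x)%:E.
Proof. by rewrite -ray_massE. Qed.

Lemma ray_mass_nondecreasing : {homo ray_mass : x y / x <= y}.
Proof. by move=> x y xy; rewrite -lee_fin -!cdf_idE cdf_nondecreasing. Qed.

(** The infimum defining the quantile is attained because the distribution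
    function is right-continuous. *)
Lemma quantile_le (u x : R) : 0 < u < 1 ->
  (quantile mu u <= x) = (u <= ray_mass x).
Proof.
move=> /andP[u0 u1]; rewrite /quantile.
set S := [set x | _].
have SE y : S y <-> u <= ray_mass y by rewrite /S /= ray_massE lee_fin.
have [l lS] : exists l, lbound S l.
  have /(cvgr_lt 0)/(_ u u0)/filter_ex[l] : ray_mass @ -oo --> (0 : R).
    by apply/fine_cvg; exact: cvg_cdfNy0 idR.
  move=> lu; exists l => y /SE uy.
  rewrite leNgt; apply/negP => /ltW/ray_mass_nondecreasing yl.
  by have := le_lt_trans (le_trans uy yl) lu; rewrite ltxx.
have S0 : S !=set0.
  have /(cvgr_gt 1)/(_ u u1)/filter_ex[z /ltW/SE] : ray_mass @ +oo --> (1 : R).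
    by apply/fine_cvg; exact: cvg_cdfy1 idR.
  by exists z.
apply/idP/idP => [Sx|/SE ux]; last by apply: ge_inf => //; exists l.
have right y : x < y -> u <= ray_mass y.
  rewrite -subr_gt0 => xy.
  have [|z /SE uz zy] := inf_adherent xy (_ : has_inf S).
    by split => //; exists l.
  apply/(le_trans uz)/ray_mass_nondecreasing/ltW/(lt_le_trans zy).
  by rewrite -lerBrDr opprB addrC subrK.
rewrite leNgt; apply/negP => xu.
have : ray_mass y @[y --> x^'+] --> ray_mass x.
  apply/fine_cvg; have := @cdf_right_continuous _ _ _ _ idR x.
  by rewrite cdf_idE.
move=> /(cvgr_lt (ray_mass x))/(_ u xu) near_lt.
have : \forall y \near x^'+, ray_mass y < u /\ x < y.
  by apply: filterI near_lt _; exact: nbhs_right_gt.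
move=> /(@filter_ex _ _ (at_right_proper_filter x))[y [yu xy]].
by have := right _ xy; rewrite leNgt yu.
Qed.

End ray_mass.

(** * Masses of quadrants for the comonotone and antimonotone couplings *)

Section uniform_law.
Context (R : realType).
Local Notation U := (uniform_prob (@ltr01 R)).

Lemma uniform_ae_itvoo : {ae U, forall u : R, 0 < u < 1}.
Proof.
exists (~` `]0, 1[); split => //.
- by apply: measurableC.
- rewrite /uniform_prob integral_uniform_pdf; apply: null_set_integral.
  + by apply: measurableI => //; exact: measurableC.
  + apply: measurable_funTS; apply/measurable_EFinP.
    exact: measurable_uniform_pdf.
  + apply: (@subset_measure0 _ _ _ lebesgue_measure _ [set 0; 1]) => //.
    * by apply: measurableI => //; exact: measurableC.
    * by apply: measurableU; exact: measurable_set1.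
    * move=> x [] /=; rewrite !in_itv/= => /negP; rewrite negb_and -!leNgt.
      move=> /orP[] x01 /andP[x0 x1]; [left|right]; apply/eqP; rewrite eq_le.
        by rewrite x01 x0.
      by rewrite x1 x01.
    * by apply: countable_lebesgue_measure0; apply: finite_set_countable.
Qed.

Lemma uniform_itvcc (l r : R) : 0 <= l -> r <= 1 ->
  U `[l, r] = (Num.max 0 (r - l))%:E.
Proof.
move=> l0 r1; rewrite /uniform_prob.
transitivity (\int[lebesgue_measure]_(x in `[l, r]) (cst 1%E x : \bar R))%E.
  apply: eq_integral => x; rewrite inE/= in_itv/= => /andP[lx xr].
  by rewrite /uniform_pdf (le_trans l0 lx) (le_trans xr r1) subr0 invr1.
rewrite integral_cst//= mul1e lebesgue_measure_itv/= lte_fin.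
have [lr|rl] := ltP l r.
  by rewrite -EFinD max_r// subr_ge0 ltW.
by rewrite max_l// subr_le0.
Qed.

(** Membership matters only for [0 < u < 1], where [quantile_le] applies; this
    hides the arbitrary values of the quantile function at the endpoints. *)
Lemma uniform_quantile_event (A : set R) (l r : R) : measurable A ->
  0 <= l -> r <= 1 -> (forall u, 0 < u < 1 -> A u <-> l <= u <= r) ->
  U A = (Num.max 0 (r - l))%:E.
Proof.
move=> mA l0 r1 AE; rewrite -uniform_itvcc//.
apply: ae_eq_measure => //.
have := uniform_ae_itvoo; apply: (@filterS _ _ (ae_filter_ringOfSetsType U)).
by move=> u /AE; rewrite /= in_itv.
Qed.

End uniform_law.

Section quadrants.
Context (R : realType) (mu nu : probability R R).

Lemma pi_com_quadrant x y :
  pi_com mu nu (quadrant x y) = (Num.min (ray_mass mu x) (ray_mass nu y))%:E.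
Proof.
have m0 : 0 <= Num.min (ray_mass mu x) (ray_mass nu y).
  by rewrite le_min !ray_mass_ge0.
transitivity (uniform_prob (@ltr01 R) (com_map mu nu @^-1` quadrant x y)) => //.
rewrite (@uniform_quantile_event _ _ 0
  (Num.min (ray_mass mu x) (ray_mass nu y)))//.
- by rewrite subr0 max_r.
- rewrite -[X in measurable X]setTI.
  by apply: measurable_com_map => //; exact: measurable_quadrant.
- by rewrite ge_min ray_mass_le1.
move=> u u01; have /andP[/ltW u0 _] := u01.
rewrite /com_map /quadrant /= !in_itv/= !quantile_le// u0 le_min /=.
by split=> [[-> ->]|/andP[]].
Qed.

Lemma pi_ant_quadrant x y :
  pi_ant mu nu (quadrant x y) =
  (Num.max 0 (ray_mass mu x + ray_mass nu y - 1))%:E.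
Proof.
transitivity (uniform_prob (@ltr01 R) (ant_map mu nu @^-1` quadrant x y)) => //.
rewrite (@uniform_quantile_event _ _ (1 - ray_mass nu y) (ray_mass mu x))//.
- by congr (Num.max _ _)%:E; ring.
- rewrite -[X in measurable X]setTI.
  by apply: measurable_ant_map => //; exact: measurable_quadrant.
- by rewrite subr_ge0 ray_mass_le1.
- exact: ray_mass_le1.
move=> u u01; have v01 : 0 < 1 - u < 1 by lra.
rewrite /ant_map /quadrant /= !in_itv/= !quantile_le//.
rewrite lerBlDr -lerBlDl.
by split=> [[-> ->]|/andP[]].
Qed.

Context (p : probability (R * R)%type R).
Hypothesis cp : coupling mu nu p.

Let E1 x : set (R * R) := fst @^-1` `]-oo, x]%classic.
Let E2 y : set (R * R) := snd @^-1` `]-oo, y]%classic.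

Let mE1 x : measurable (E1 x).
Proof. by rewrite -[E1 x]setTI; exact: measurable_fst. Qed.

Let mE2 y : measurable (E2 y).
Proof. by rewrite -[E2 y]setTI; exact: measurable_snd. Qed.

Let pE1 x : p (E1 x) = (ray_mass mu x)%:E.
Proof. by rewrite -ray_massE -cp.1. Qed.

Let pE2 y : p (E2 y) = (ray_mass nu y)%:E.
Proof. by rewrite -ray_massE -cp.2. Qed.

Let quadrantE x y : quadrant x y = E1 x `&` E2 y. Proof. by []. Qed.

(** On an increasing line, [z.1 <= x] and [z.2 <= y] are nested events, in an
    order decided by the side of the line on which [(x, y)] lies. *)
Lemma increasing_line_quadrant (a c x y : R) : 0 < a -> on_line p a c ->
  p (quadrant x y) = (Num.min (ray_mass mu x) (ray_mass nu y))%:E.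
Proof.
move=> a0 pL; rewrite quadrantE EFin_min -pE1 -pE2.
have [xy|yx] := leP (a * x + c) y.
- have sub12 : {ae p, forall z, E1 x z -> E2 y z}.
    apply: filterS pL => z zL; rewrite /E1 /E2 /= !in_itv/= zL => zx.
    by rewrite (le_trans _ xy)// lerD2r ler_pM2l.
  rewrite min_l; last exact: ae_le_measure.
  apply: ae_eq_measure => //; first exact: measurableI.
  by apply: filterS sub12 => z sub; split=> [[]|E1z]//; split=> //; exact: sub.
- have sub21 : {ae p, forall z, E2 y z -> E1 x z}.
    apply: filterS pL => z zL; rewrite /E1 /E2 /= !in_itv/= zL => zy.
    by rewrite -(ler_pM2l a0) -(lerD2r c) ltW// (le_lt_trans zy).
  rewrite min_r; last exact: ae_le_measure.
  apply: ae_eq_measure => //; first exact: measurableI.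
  by apply: filterS sub21 => z sub; split=> [[]|E2z]//; split=> //; exact: sub.
Qed.

(** On a decreasing line, the events [z.1 <= x] and [z.2 <= y] cover the line or
    are disjoint, according to the side of the line on which [(x, y)] lies; the
    value follows by inclusion-exclusion. *)
Lemma decreasing_line_quadrant (a c x y : R) : a < 0 -> on_line p a c ->
  p (quadrant x y) = (Num.max 0 (ray_mass mu x + ray_mass nu y - 1))%:E.
Proof.
move=> a0 pL; rewrite quadrantE.
have mE12 : measurable (E1 x `&` E2 y) by exact: measurableI.
have [i iE] : exists i, p (E1 x `&` E2 y) = i%:E.
  by exists (fine (p (E1 x `&` E2 y))); rewrite fineK// fin_num_measure.
have incl_excl : p (E1 x `|` E2 y) = (ray_mass mu x + ray_mass nu y - i)%:E.
  have -> : (ray_mass mu x + ray_mass nu y - i)%:E =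
      ((ray_mass mu x)%:E + (ray_mass nu y)%:E - i%:E)%E by [].
  rewrite -pE1 -pE2 -iE measureUfinr//.
  by apply: le_lt_trans (probability_le1 p (mE2 y)) _; rewrite ltry.
have [xy|yx] := leP (a * x + c) y.
- have cover : p (E1 x `|` E2 y) = 1%E.
    rewrite -(probability_setT p); apply: ae_eq_measure => //.
      exact: measurableU.
    apply: filterS pL => z zL; split=> // _; rewrite /E1 /E2 /= !in_itv/=.
    have [zx|xz] := leP z.1 x; [by left|right].
    by rewrite zL (le_trans _ xy)// lerD2r ler_nM2l// ltW.
  have i0 : 0 <= i by rewrite -lee_fin -iE measure_ge0.
  move: incl_excl; rewrite cover => -[]; rewrite iE => iFG.
  by rewrite max_r; [congr _%:E|]; lra.
- have disj : p (E1 x `&` E2 y) = 0%E.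
    rewrite -(measure0 p); apply: ae_eq_measure => //.
    apply: filterS pL => z zL; split=> // -[].
    rewrite /E1 /E2 /= !in_itv/= zL => zx zy.
    have : a * x + c <= y by rewrite (le_trans _ zy)// lerD2r ler_nM2l.
    by rewrite leNgt yx.
  have i0 : i = 0 by apply/EFin_inj; rewrite -iE disj.
  have : (p (E1 x `|` E2 y) <= 1)%E by exact/probability_le1/measurableU.
  by rewrite incl_excl i0 subr0 lee_fin disj => h; rewrite max_l// subr_le0.
Qed.

Lemma on_increasing_line (a c : R) : 0 < a -> on_line p a c ->
  same_measure p (pi_com mu nu).
Proof.
move=> a0 pL; apply: eq_on_quadrants => x y.
by rewrite (increasing_line_quadrant _ _ a0 pL) pi_com_quadrant.
Qed.

Lemma on_decreasing_line (a c : R) : a < 0 -> on_line p a c ->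
  same_measure p (pi_ant mu nu).
Proof.
move=> a0 pL; apply: eq_on_quadrants => x y.
by rewrite (decreasing_line_quadrant _ _ a0 pL) pi_ant_quadrant.
Qed.

End quadrants.

(** * Symmetry and the two possible slopes *)

Lemma coupling_on_line_marginal (R : realType) (a c : R)
    (mu nu : probability R R) (p : probability (R * R)%type R) :
  coupling mu nu p -> on_line p a c ->
  same_measure nu (pushforward mu (fun x : R => a * x + c)).
Proof.
move=> [p1 p2] pL A mA; rewrite -p2// /pushforward.
have mB := measurable_affine_preimage a c mA.
rewrite -[RHS]p1// /pushforward; apply: ae_eq_measure.
- by rewrite -[X in measurable X]setTI; exact: measurable_snd.
- by rewrite -[X in measurable X]setTI; exact: measurable_fst.
- by apply: filterS pL => z /= <-.
Qed.

Lemma reflection_image (R : realType) (m : R) (A : set R) :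
  [set m - x | x in A] = (fun x => -1 * x + m) @^-1` A.
Proof.
apply/seteqP; split => x /=; last first.
  by move=> Ax; exists (-1 * x + m) => //; ring.
by move=> [y Ay <-]; rewrite (_ : -1 * (m - y) + m = y)//; ring.
Qed.

(** Composing [x |-> a * x + b] with the reflection [x |-> m - x] reverses its
    slope; conversely, two affine maps with opposite slopes and the same image
    law differ by the reflection with [m = (c - b) / a]. *)
Lemma symmetric_lawP (R : realType) (a b : R) (mu nu : probability R R) :
  a != 0 -> same_measure nu (pushforward mu (fun x : R => a * x + b)) ->
  symmetric_law mu <->
  exists c, same_measure nu (pushforward mu (fun x : R => - a * x + c)).
Proof.
move=> a0 nuE; split=> [[m muS]|[c nuE']].
  exists (a * m + b) => A mA; rewrite nuE// /pushforward.
  rewrite muS; last exact: measurable_affine_preimage.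
  have flip x : a * (-1 * x + m) + b = - a * x + (a * m + b) by ring.
  by rewrite reflection_image; congr (mu _); apply/seteqP; split=> x /=;
    rewrite flip.
exists ((c - b) / a) => A mA; rewrite reflection_image.
pose B := (fun y => a^-1 * y + - (a^-1 * b)) @^-1` A.
have mB : measurable B by exact: measurable_affine_preimage.
have scaleK x : a^-1 * (a * x + b) + - (a^-1 * b) = x by field.
have reflect x : a^-1 * (- a * x + c) + - (a^-1 * b) = -1 * x + (c - b) / a.
  by field.
transitivity (nu B); [rewrite nuE//|rewrite nuE'//]; congr (mu _);
  by apply/seteqP; split=> x; rewrite /B /= ?scaleK ?reflect.
Qed.

Definition monotone_coupling (R : realType) (a : R) (mu nu : probability R R) :
    probability (R * R)%type R :=
  if 0 < a then pi_com mu nu else pi_ant mu nu.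

Lemma on_line_monotone_coupling (R : realType) (a c : R)
    (mu nu : probability R R) (p : probability (R * R)%type R) :
  a != 0 -> coupling mu nu p -> on_line p a c ->
  same_measure p (monotone_coupling a mu nu).
Proof.
rewrite neq_lt /monotone_coupling => a0 cp pL; case: ifPn => [ap|].
  exact: on_increasing_line pL.
by move: a0 => /orP[an _|-> //]; exact: on_decreasing_line pL.
Qed.

(** A line coupling of either slope is the monotone coupling of that direction.
    For the converse, the monotone coupling has to be recognized as a line
    coupling, and this is where the symmetry of [mu] is needed for the slope
    [- a]. *)
Lemma location_scale_minimizers (R : realType) (g a b : R)
    (mu nu : probability R R) (p : probability (R * R)%type R) :
  0 < g -> a != 0 ->
  same_measure nu (pushforward mu (fun x : R => a * x + b)) ->
  minimizer g mu nu p <->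
  same_measure p (monotone_coupling a mu nu) \/
  (symmetric_law mu /\ same_measure p (monotone_coupling (- a) mu nu)).
Proof.
move=> g0 a0 nuE; have na0 : - a != 0 by rewrite oppr_eq0.
have minP q := minimizer_on_line q g0 a0 nuE.
rewrite (symmetric_lawP a0 nuE).
split=> [/minP[cp [c [pL|pL]]]|].
- by left; exact: on_line_monotone_coupling cp pL.
- right; split; last exact: on_line_monotone_coupling cp pL.
  by exists c; exact: coupling_on_line_marginal cp pL.
have attained s c : s != 0 ->
    same_measure nu (pushforward mu (fun x : R => s * x + c)) ->
    same_measure p (monotone_coupling s mu nu) ->
    (forall q : probability (R * R)%type R,
      coupling mu nu q -> on_line q s c -> minimizer g mu nu q) ->
    minimizer g mu nu p.
  move=> s0 nuEs pE qmin; have [q cq qL] := graph_coupling_exists nuEs.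
  apply: (minimizer_same_measure _ (qmin q cq qL)) => A mA.
  by rewrite pE// (on_line_monotone_coupling s0 cq qL).
move=> [pE|[[c nuE'] pE]].
  apply: attained nuE pE _ => // q cq qL.
  by apply/minP; split=> //; exists b; left.
apply: attained nuE' pE _ => // q cq qL.
by apply/minP; split=> //; exists c; right.
Qed.

Theorem proposition16 (R : realType) (gamma : R) (mu nu : probability R R) :
  0 < gamma ->
  mu.-integrable [set: R] (fun x : R => x%:E) ->
  (increasing_location_scale mu nu ->
     (symmetric_law mu ->
        forall p : probability (R * R)%type R,
          minimizer gamma mu nu p <->
          same_measure p (pi_com mu nu) \/ same_measure p (pi_ant mu nu)) /\
     (~ symmetric_law mu ->
        forall p : probability (R * R)%type R,
          minimizer gamma mu nu p <-> same_measure p (pi_com mu nu))) /\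
  (decreasing_location_scale mu nu ->
     (symmetric_law mu ->
        forall p : probability (R * R)%type R,
          minimizer gamma mu nu p <->
          same_measure p (pi_com mu nu) \/ same_measure p (pi_ant mu nu)) /\
     (~ symmetric_law mu ->
        forall p : probability (R * R)%type R,
          minimizer gamma mu nu p <-> same_measure p (pi_ant mu nu))).
Proof.
move=> g0 _; split=> -[a [b [a0 nuE]]].
  have aN0 : a != 0 by rewrite gt_eqF.
  have main p := location_scale_minimizers p g0 aN0 nuE.
  rewrite /monotone_coupling a0 oppr_gt0 (le_gtF (ltW a0)) in main.
  split=> symmu p; rewrite main.
    by split=> [[|[_]]|[]]; [left|right|left|right].
  by split=> [[pE|[/symmu[]]]|pE]; [exact: pE|left].
have aN0 : a != 0 by rewrite lt_eqF.
have main p := location_scale_minimizers p g0 aN0 nuE.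
rewrite /monotone_coupling oppr_gt0 a0 (le_gtF (ltW a0)) in main.
split=> symmu p; rewrite main.
  by split=> [[|[_]]|[]]; [right|left|right|left].
by split=> [[pE|[/symmu[]]]|pE]; [exact: pE|left].
Qed.
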